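(* Let $n$ be a positive integer. For non-negative integers $m,u_0,\dots,u_{n-1},v_0,\dots,v_{n-1}$, let $\tilde P_n(m;u_0,\dots,u_{n-1};v_0,\dots,v_{n-1})$ be the number of partitions of $m$ in $\mathcal{P}_n$ such that for each $i\in\{0,\dots,n-1\}$, the symbol $a_i$ (resp. $b_i$) appears $u_i$ (resp. $v_i$) times among the bound colours of the parts; and let $\tilde F_n(m;u_0,\dots,u_{n-1};v_0,\dots,v_{n-1})$ be the number of $n^2$-coloured Frobenius partitions of weight $m$ such that for each $i$, the symbol $a_i$ (resp. $b_i$) appears $u_i$ (resp. $v_i$) times among the bound colours of its colour sequence. Then $$\tilde P_n(m;u_0,\dots,u_{n-1};v_0,\dots,v_{n-1})=\tilde F_n(m;u_0,\dots,u_{n-1};v_0,\dots,v_{n-1}).$$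
   Context: Colours are symbols $a_ib_k$ with $0\le i,k\le n-1$; $a_ib_i$ is free and $a_ib_k$ ($i\ne k$) is bound; the colour $a_ib_k$ contains the symbol $a_i$ once and $b_k$ once. With $\chi(P)\in\{0,1\}$ the truth value of $P$, define $\Delta(a_ib_k,a_{i'}b_{k'})=\chi(i\ge i')-\chi(i=k=i')+\chi(k\le k')-\chi(k=i'=k')$. $\mathcal{P}_n$ is the set of coloured partitions $\lambda_1+\dots+\lambda_s$ (sequence of positive integers, each with a colour $c(\lambda_j)$ among the $a_ib_k$) with $\lambda_j-\lambda_{j+1}\ge\Delta(c(\lambda_j),c(\lambda_{j+1}))$ for all $j$; its weight is $\sum\lambda_j$. An $n^2$-coloured Frobenius partition is a two-rowed array $\begin{pmatrix}\lambda_1&\cdots&\lambda_s\\ \mu_1&\cdots&\mu_s\end{pmatrix}$ ($s\ge0$) where $\lambda_1>\dots>\lambda_s$ are non-negative integers each coloured by some $a_i$ ($0\le i\le n-1$), strictly decreasing for the order $0_{a_{n-1}}<0_{a_{n-2}}<\dots<0_{a_0}<1_{a_{n-1}}<\dots<1_{a_0}<2_{a_{n-1}}<\cdots$, and $\mu_1>\dots>\mu_s$ are non-negative integers each coloured by some $b_i$, strictly decreasing for the order $0_{b_0}<0_{b_1}<\dots<0_{b_{n-1}}<1_{b_0}<\dots<1_{b_{n-1}}<\cdots$. Its weight is $s+\sum_j\lambda_j+\sum_j\mu_j$, and its colour sequence is $(c(\lambda_1)c(\mu_1),\dots,c(\lambda_s)c(\mu_s))$, each entry being a colour $a_ib_k$.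 *)

(* Defs.v *)
From mathcomp Require Import all_boot all_order all_algebra.
From mathcomp Require Import finmap boolp classical_sets functions cardinality.

Set Implicit Arguments.
Unset Strict Implicit.
Unset Printing Implicit Defensive.

Local Open Scope ring_scope.

(* The pair (i, k) stands for the colour a_i b_k. *)
Definition colour (n : nat) := ('I_n * 'I_n)%type.

Definition is_free n (c : colour n) : bool := c.1 == c.2.
Definition is_bound n (c : colour n) : bool := ~~ is_free c.

Definition chi (b : bool) : int := Posz (nat_of_bool b).

Definition Delta n (c c' : colour n) : int :=
  let: (i, k) := c in
  let: (i', k') := c' in
  chi (i' <= i)%N - chi ((i == k) && (k == i'))
  + chi (k <= k')%N - chi ((k == i') && (i' == k')).

Definition bound_a n (i : 'I_n) (s : seq (colour n)) : nat :=
  count (fun c => is_bound c && (c.1 == i)) s.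
Definition bound_b n (i : 'I_n) (s : seq (colour n)) : nat :=
  count (fun c => is_bound c && (c.2 == i)) s.

Definition row_weight (T : Type) (r : seq (nat * T)) : nat :=
  sumn (map fst r).

(* A part is a pair (size, colour), listed from lambda_1 to lambda_s. *)
Definition in_P n (l : seq (nat * colour n)) : bool :=
  all (fun x => 0 < x.1)%N l &&
  sorted (fun x y => Delta x.2 y.2 <= Posz x.1 - Posz y.1) l.

Definition part_colours n (l : seq (nat * colour n)) : seq (colour n) :=
  map snd l.

(* (x, i) encodes the integer x with colour a_i, resp. b_i. *)
Definition lt_a n (x y : nat * 'I_n) : bool :=
  (x.1 < y.1)%N || (x.1 == y.1) && (y.2 < x.2)%N.
Definition lt_b n (x y : nat * 'I_n) : bool :=
  (x.1 < y.1)%N || (x.1 == y.1) && (x.2 < y.2)%N.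

(* A two-rowed array is the pair of its top and bottom rows. *)
Definition array (n : nat) := (seq (nat * 'I_n) * seq (nat * 'I_n))%type.

Definition is_frobenius n (f : array n) : bool :=
  [&& size f.1 == size f.2,
      sorted (fun x y => lt_a y x) f.1 &
      sorted (fun x y => lt_b y x) f.2].

Definition frob_weight n (f : array n) : nat :=
  (size f.1 + row_weight f.1 + row_weight f.2)%N.

Definition frob_colours n (f : array n) : seq (colour n) :=
  zip (map snd f.1) (map snd f.2).

Local Open Scope classical_set_scope.

Definition Ptilde_set n (m : nat) (u v : 'I_n -> nat) :
    set (seq (nat * colour n)) :=
  [set l | [/\ in_P l, row_weight l = m &
     forall i, bound_a i (part_colours l) = u i /\
               bound_b i (part_colours l) = v i]].

Definition Ftilde_set n (m : nat) (u v : 'I_n -> nat) : set (array n) :=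
  [set f | [/\ is_frobenius f, frob_weight f = m &
     forall i, bound_a i (frob_colours f) = u i /\
               bound_b i (frob_colours f) = v i]].

(* [fset_set] is empty on infinite sets; [finite_Ptilde_set] and
   [finite_Ftilde_set] below show that this does not happen here. *)
Definition Ptilde n (m : nat) (u v : 'I_n -> nat) : nat :=
  #|` fset_set (Ptilde_set m u v) |%fset.

Definition Ftilde n (m : nat) (u v : 'I_n -> nat) : nat :=
  #|` fset_set (Ftilde_set m u v) |%fset.

Lemma finite_bounded_rows (T : finType) (m : nat) :
  finite_set [set r : seq (nat * T) | (size r <= m)%N /\ (row_weight r <= m)%N].
Proof.
suff fin k : finite_set
    [set r : seq (nat * T) | (size r <= k)%N /\ all (fun x => x.1 <= m)%N r].
  apply: sub_finite_set (fin m) => r /= [-> wr]; split=> //.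
  elim: r wr => //= x r IH; rewrite /row_weight /= => wr.
  by rewrite (leq_trans (leq_addr _ _) wr) IH // (leq_trans (leq_addl _ _) wr).
pose A := [seq (i, t) | i <- iota 0 m.+1, t <- enum T].
have inA x : (x \in A) = (x.1 <= m)%N.
  apply/allpairsP/idP => [[[i t] [+ _ ->]]|xm].
    by rewrite mem_iota add0n ltnS.
  by exists x; rewrite mem_iota add0n ltnS mem_enum; split=> //; case: (x).
elim: k => [|k IH].
  by apply: sub_finite_set (finite_set1 [::]) => -[|x r] [].
case/finite_seqP: IH => e eE.
have ine r : (r \in e) <-> (size r <= k)%N /\ all (fun x => x.1 <= m)%N r.
  by rewrite -[_ /\ _]/([set r : seq (nat * T) | _ /\ _] r) eE.
apply/finite_seqP; exists ([::] :: [seq x :: r | x <- A, r <- e]).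
apply/seteqP; split=> r /=; rewrite in_cons.
  case: r => [|x r] //= [sr /andP[xm rm]].
  by apply/allpairsP; exists (x, r); split=> //=; [rewrite inA|apply/ine].
case/orP=> [/eqP->//|/allpairsP[[x r'] /= [xin /ine[sr rm] ->]]].
by split=> //=; rewrite rm andbT -inA.
Qed.

Lemma finite_Ptilde_set n m (u v : 'I_n -> nat) : finite_set (Ptilde_set m u v).
Proof.
apply: sub_finite_set (finite_bounded_rows (colour n) m).
move=> l [/andP[pos _] <- _]; split=> //.
elim: l pos => //= x l IH /andP[x0 /IH]; rewrite /row_weight /= => h.
by rewrite -add1n leq_add.
Qed.

Lemma finite_Ftilde_set n m (u v : 'I_n -> nat) : finite_set (Ftilde_set m u v).
Proof.
have fin := finite_bounded_rows 'I_n m.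
apply: sub_finite_set (finite_setX fin fin).
move=> -[a b] [/and3P[/= /eqP sE _ _] <- _]; rewrite /frob_weight /=.
split=> /=; split.
- by rewrite -addnA leq_addr.
- by rewrite addnAC leq_addl.
- by rewrite -sE -addnA leq_addr.
- exact: leq_addl.
Qed.

(* Main.v *)
Require Import Defs.
From mathcomp Require Import all_boot all_order all_algebra.
From mathcomp Require Import finmap boolp classical_sets functions cardinality.
From mathcomp Require Import zify ring.

(* Fix the sequence B of bound colours and insert free colours freely. For a
   colour c, let e_L(c) be the generating function of partitions in P_n with L
   parts and bound colours B that may be followed by a virtual part of size 0
   and colour c, and let f_L(c) be its analogue for the larger gaps
   Delta'(a_i b_k, a_i' b_k') = chi(i >= i') + chi(k <= k'), which are the gaps
   of the sums lambda_j + mu_j + 1 of a Frobenius partition. Both satisfy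
     (1 - q^L) e_L(c) = \sum_c' q^(L Delta(c', c)) e_(L-1)(c'),
   and induction on L and on B gives, with Gaussian binomials [L, k],
     e_L(a_i b_k) = \sum_k' q^(chi(i < k) (L - k')) [L, k'] f_k'(a_i b_k), i <> k,
     e_L(a_j b_j) = \sum_k [L+1, k+1] f_k(a_j b_j) + (a term for the last bound
                    colour, present if its second symbol is b_j).
   Hence the partitions in P_n with L + 1 parts have generating function
     \sum_k q^(L-k) [L, k] F_k,
   where F_k counts coloured partitions into k + 1 parts with gaps Delta'. Since
   \sum_L q^(L-k) [L, k] = 1/((1-q)...(1-q^(k+1))), and since a Frobenius
   partition is such a partition together with an ordinary partition into at
   most k + 1 parts, summing over L proves the theorem. Power series are
   truncated: q is nilpotent. *)

Set Implicit Arguments.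
Unset Strict Implicit.
Unset Printing Implicit Defensive.

Import Order.TTheory GRing.Theory Num.Theory.
Local Open Scope ring_scope.

(* [ring] does not always normalise powers with a symbolic exponent. *)
Ltac ring_pow :=
  rewrite ?expr0 ?expr1;
  repeat match goal with |- context [?x ^+ ?k] => generalize (x ^+ k); intro end;
  ring.

(** * Gaussian binomials *)

Section QBinomial.

Variables (R : comNzRingType) (q : R).
Implicit Types (A B : nat -> R) (L k m : nat).

Fixpoint qbin L k : R :=
  match L, k with
  | _, 0 => 1
  | 0, _.+1 => 0
  | L'.+1, k'.+1 => qbin L' k' + q ^+ k * qbin L' k
  end.

Arguments qbin : simpl never.

Lemma qbin0 L : qbin L 0 = 1. Proof. by case: L. Qed.

Lemma qbinS L k : qbin L.+1 k.+1 = qbin L k + q ^+ k.+1 * qbin L k.+1.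
Proof. by []. Qed.

Lemma qbin_small L k : (L < k)%N -> qbin L k = 0.
Proof.
elim: L k => [|L IH] [|k] //; rewrite ltnS => ltLk.
by rewrite qbinS !IH ?mulr0 ?addr0 // ltnW.
Qed.

Lemma qbinn L : qbin L L = 1.
Proof. by elim: L => // L IH; rewrite qbinS IH qbin_small ?mulr0 ?addr0. Qed.

(** The second q-Pascal rule. Expanding by the definition, using the rule one level down and folding
    back gives the induction step. *)
Lemma qbinS_alt L k : (k <= L)%N ->
  qbin L.+1 k.+1 = qbin L k.+1 + q ^+ (L - k) * qbin L k.
Proof.
elim: L k => [|L IH] k lekL.
  by by move: lekL; rewrite leqn0 => /eqP->; rewrite !qbinn qbin_small // add0r mulr1.
case: (ltngtP k L.+1) lekL => [ltkL||->] // _; last first.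
  by rewrite subnn mul1r !qbinn qbin_small // add0r.
case: k ltkL => [|k] ltkL.
  rewrite [LHS]qbinS [in LHS]IH // [in RHS]qbinS !subn0 !qbin0 expr1 exprS; ring_pow.
rewrite [LHS]qbinS [in LHS]IH 1?ltnW // [in LHS]IH // [qbin L.+1 k.+2]qbinS.
rewrite [qbin L.+1 k.+1]qbinS.
have -> : (L.+1 - k.+1 = (L - k.+1).+1)%N by lia.
have -> : (L - k = (L - k.+1).+1)%N by lia.
by rewrite !exprS; ring_pow.
Qed.

Lemma exprS_sub L k : (k <= L)%N -> q ^+ L.+1 = q ^+ k.+1 * q ^+ (L - k).
Proof. by move=> lekL; rewrite -exprD addSn subnKC. Qed.

Lemma qbin_mulS L k : (k <= L)%N ->
  (1 - q ^+ k.+1) * qbin L k.+1 = (1 - q ^+ (L - k)) * qbin L k.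
Proof.
move=> lekL; have := qbinS_alt lekL; rewrite qbinS.
move=> /(canLR (addrK _)) /esym eq1; rewrite mulrBl mul1r.
by rewrite mulrBl mul1r {1}eq1; ring_pow.
Qed.

Lemma qbinSS_mul L k :
  (1 - q ^+ k.+1) * qbin L.+1 k.+1 = (1 - q ^+ L.+1) * qbin L k.
Proof.
case: (leqP k L) => [lekL|ltLk]; last by rewrite !qbin_small ?mulr0.
rewrite qbinS mulrDr mulrCA qbin_mulS //.
by rewrite (exprS_sub lekL); ring_pow.
Qed.

Lemma qbin_diag L k : (k <= L)%N ->
  (1 - q ^+ k) * qbin L k + q ^+ k * (1 - q ^+ k.+1) * qbin L k.+1
  = (1 - q ^+ L) * qbin L k.
Proof.
move=> lekL; rewrite -mulrA qbin_mulS //.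
by rewrite -[in q ^+ L](subnKC lekL) exprD; ring_pow.
Qed.

(* [tr1], [trb] are the transforms from gaps Delta' to gaps Delta before a free,
   resp. bound, next colour (with [t] for [i < k]); [rho] is the correction
   due to the last bound colour. *)
Definition tr1 A L := \sum_(k < L.+1) qbin L.+1 k.+1 * A k.

Definition trb (t : bool) A L :=
  \sum_(k < L.+1) q ^+ (t * (L - k)) * qbin L k * A k.

Definition rho (t : bool) A L :=
  \sum_(k < L.+1) q ^+ (~~ t * k.+1) * qbin L k.+1 * A k.

Lemma rho0 t A : rho t A 0 = 0.
Proof. by rewrite /rho big_ord1 qbin_small // mulr0 mul0r. Qed.

Lemma rhoE t A L :
  rho t A L.+1 = \sum_(k < L.+1) q ^+ (~~ t * k.+1) * qbin L.+1 k.+1 * A k.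
Proof. by rewrite /rho big_ord_recr /= [qbin _ L.+2]qbin_small // mulr0 mul0r addr0. Qed.

(** The two q-Pascal rules, one for each value of [t]. *)
Lemma tr1_rho t A L : tr1 A L = trb t A L + rho t A L.
Proof.
rewrite -big_split; apply: eq_bigr => k _ /=; rewrite -mulrDl; congr (_ * _).
case: t; rewrite /= ?mul1n ?mul0n expr0 ?mul1r //.
by rewrite qbinS_alt -1?ltnS // addrC.
Qed.

Lemma rhoS t A L : rho t A L.+1 = rho t A L + q ^+ (~~ t * L.+1) * trb t A L.
Proof.
rewrite rhoE mulr_sumr -big_split; apply: eq_bigr => k _ /=.
have lekL : (k <= L)%N by rewrite -ltnS.
case: t; rewrite /= ?mul1n ?mul0n !expr0 ?mul1r.
  by rewrite qbinS_alt // mulrDl.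
by rewrite qbinS_alt // (exprS_sub lekL); ring_pow.
Qed.

Lemma tr1_rev A L :
  \sum_(k < L.+1) q ^+ (L - k) * qbin L.+1 k.+1 * A k
  = trb true A L + q ^+ L.+1 * rho true A L.
Proof.
rewrite mulr_sumr -big_split; apply: eq_bigr => k _ /=.
have lekL : (k <= L)%N by rewrite -ltnS.
by rewrite mul1n mul0n expr0 qbinS (exprS_sub lekL); ring_pow.
Qed.

(** The combination in the last sum is the one that the recurrence with gaps Delta' evaluates at a
    free colour; see [free_transform]. *)
Lemma tr1S A L :
  (1 - q ^+ L.+1) * tr1 A L.+1 = (1 - q ^+ L.+1) * tr1 A L +
  \sum_(k < L.+1) q ^+ (L - k) * qbin L.+1 k.+1 *
     ((1 - q ^+ k.+1) * (A k.+1 + q ^+ k.+1 * A k)).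
Proof.
rewrite -[LHS](subrK ((1 - q ^+ L.+1) * tr1 A L)) [LHS]addrC.
congr (_ + _); rewrite -mulrBr.
have -> : tr1 A L = \sum_(k < L.+2) qbin L.+1 k.+1 * A k.
  by rewrite big_ord_recr /= [qbin _ L.+2]qbin_small // mul0r addr0.
rewrite -sumrB.
under eq_bigr => k _ do rewrite -mulrBl.
(* The coefficient of [A k] grows by q^(L+1-k) [L+1, k]. [qbin_diag] splits this, and shifting the
   index in the first half, whose term at 0 vanishes, pairs [A k.+1] with [A k]. *)
transitivity (\sum_(k < L.+2) q ^+ (L.+1 - k) * ((1 - q ^+ k) * qbin L.+1 k
   + q ^+ k * (1 - q ^+ k.+1) * qbin L.+1 k.+1) * A k).
  rewrite mulr_sumr; apply: eq_bigr => k _.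
  have lekL : (k <= L.+1)%N by rewrite -ltnS.
  by rewrite qbinS_alt // qbin_diag //; ring_pow.
under eq_bigr => k _ do rewrite mulrDr mulrDl.
rewrite big_split /= [X in X + _]big_ord_recl /= expr0 subrr mul0r mulr0 mul0r add0r.
rewrite [X in _ + X]big_ord_recr /= [qbin _ L.+2]qbin_small // !(mulr0, mul0r, addr0).
rewrite -big_split; apply: eq_bigr => k _ /=.
rewrite /bump add1n subSS.
have -> : (L.+1 - k = (L - k).+1)%N by have := ltn_ord k; lia.
by rewrite !exprS; ring_pow.
Qed.

End QBinomial.

Arguments qbin : simpl never.

(** * Gaps *)

(* [gapF] and [gapP] take the indices of a_i b_k and a_i' b_k' in this order. *)
Definition gapF (i k i' k' : nat) : nat := ((i' <= i) + (k <= k'))%N.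

Definition gapP (i k i' k' : nat) : nat :=
  (((i' <= i) && ~~ ((i == k) && (k == i'))) +
   ((k <= k') && ~~ ((k == i') && (i' == k'))))%N.

Lemma gapP_free j w : gapP j j w w = (j != w).
Proof. by rewrite /gapP !eqxx andbT /=; case: (ltngtP w j). Qed.

Lemma gapF_free j w : gapF j j w w = (j == w).+1.
Proof. by rewrite /gapF; case: (ltngtP w j). Qed.

Section GapDifference.

Variables (R : comNzRingType) (x : R).

(** Before a free colour the two kinds of gap differ only if j = z; this is the source of [rho] in
    [free_transform]. *)
Lemma gapP_bound_free y z j : y != z ->
  x ^+ gapP y z j j =
  x ^+ gapF y z j j + (j == z)%:R * (1 - x) * x ^+ (~~ (y < z)%N).
Proof.
rewrite /gapP /gapF => /negPf->; rewrite eqxx andbT -leqNgt /=.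
rewrite [z == j]eq_sym; case: eqP => [->|_]; last by rewrite !andbT !mul0r addr0.
by rewrite leqnn !exprD /= !andbT; ring_pow.
Qed.

(** Here and below [x] stands for q^(L+1). Moving the next colour from a_i b_i to a_i b_k changes
    [x] to the gap by a multiple of 1 - x, which the recurrence can cancel. *)
Lemma gapP_gt j i k : (k < i)%N ->
  x ^+ gapP j j i k - x ^+ gapP j j i i = (1 - x) * (k < j < i)%N%:R.
Proof.
move=> ltki; rewrite gapP_free /gapP eqxx /=.
by case: (ltngtP j i) => [?|?|?]; case: (ltngtP j k) => [?|?|?];
  subst; rewrite /= ?(gtn_eqF ltki) ?ltnn ?addn0 ?add0n ?expr0 ?expr1; try ring; lia.
Qed.

Lemma gapF_gt j i k : (k < i)%N ->
  x ^+ gapF j j i k - x ^+ gapF j j i i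
  = (1 - x) * ((k < j < i)%N%:R + x * (j == i)%:R).
Proof.
move=> ltki; rewrite gapF_free /gapF.
by case: (ltngtP j i) => [?|?|?]; case: (ltngtP j k) => [?|?|?];
  rewrite /= ?addn0 ?add0n ?expr0 ?expr1; try ring; lia.
Qed.

Lemma gapP_lt j i k : (i < k)%N ->
  x ^+ gapP j j i k - x ^+ gapP j j i i
  = (1 - x) * - ((j == i)%:R + x * (i < j <= k)%N%:R).
Proof.
move=> ltik; rewrite gapP_free /gapP eqxx /=.
by case: (ltngtP j i) => [?|?|?]; case: (ltngtP j k) => [?|?|?];
  subst; rewrite /= ?(ltn_eqF ltik) ?ltnn ?addn0 ?add0n ?expr0 ?expr1; try ring; lia.
Qed.

Lemma gapF_lt j i k : (i < k)%N ->
  x ^+ gapF j j i k - x ^+ gapF j j i i = (1 - x) * - (x * (i < j <= k)%N%:R).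
Proof.
move=> ltik; rewrite gapF_free /gapF.
by case: (ltngtP j i) => [?|?|?]; case: (ltngtP j k) => [?|?|?];
  rewrite /= ?addn0 ?add0n ?expr0 ?expr1; try ring; lia.
Qed.

Lemma gapP_bound_gt y z i k : y != z -> (k < i)%N ->
  x ^+ gapP y z i k - x ^+ gapP y z i i
  = (1 - x) * ((k < z < i)%N%:R * x ^+ (i <= y)%N).
Proof.
rewrite /gapP => /negPf-> ltki; rewrite eqxx andbT /= !exprD (gtn_eqF ltki) !andbF !andbT.
by case: (ltngtP z i) => [?|?|?]; case: (ltngtP z k) => [?|?|?];
  rewrite /= ?expr0 ?expr1; try ring_pow; lia.
Qed.

Lemma gapF_bound_gt y z i k : (k < i)%N ->
  x ^+ gapF y z i k - x ^+ gapF y z i i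
  = (1 - x) * ((k < z <= i)%N%:R * x ^+ (i <= y)%N).
Proof.
rewrite /gapF => ltki; rewrite !exprD.
by case: (ltngtP z i) => [?|?|?]; case: (ltngtP z k) => [?|?|?];
  rewrite /= ?expr0 ?expr1; try ring_pow; lia.
Qed.

Lemma gapP_bound_lt y z i k : y != z -> (i < k)%N ->
  x ^+ gapP y z i k - x ^+ gapP y z i i
  = (1 - x) * - ((i <= z <= k)%N%:R * x ^+ (i <= y)%N).
Proof.
rewrite /gapP => /negPf-> ltik; rewrite eqxx andbT /= !exprD (ltn_eqF ltik) !andbF !andbT.
by case: (ltngtP z i) => [?|?|?]; case: (ltngtP z k) => [?|?|?];
  rewrite /= ?expr0 ?expr1; try ring_pow; lia.
Qed.

Lemma gapF_bound_lt y z i k : (i < k)%N ->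
  x ^+ gapF y z i k - x ^+ gapF y z i i
  = (1 - x) * - ((i < z <= k)%N%:R * x ^+ (i <= y)%N).
Proof.
rewrite /gapF => ltik; rewrite !exprD.
by case: (ltngtP z i) => [?|?|?]; case: (ltngtP z k) => [?|?|?];
  rewrite /= ?expr0 ?expr1; try ring_pow; lia.
Qed.

End GapDifference.

Lemma trb_recl (R : comNzRingType) (q : R) t A L :
  trb q t A L.+1 = q ^+ (t * L.+1) * A 0
    + \sum_(m < L.+1) q ^+ (t * (L - m)) * qbin q L.+1 m.+1 * A m.+1.
Proof.
by rewrite /trb big_ord_recl subn0 qbin0 mulr1.
Qed.

Lemma sum_delta (R : pzSemiRingType) (n z : nat) (P : pred nat) :
  \sum_(j < n) (P j)%:R * (j == z :> nat)%:R = ((z < n)%N && P z)%:R :> R.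
Proof.
case: (ltnP z n) => [ltzn|lenz] /=; last first.
  by rewrite big1 // => j _; rewrite ltn_eqF ?mulr0 // (leq_trans (ltn_ord j)).
rewrite (bigD1 (Ordinal ltzn)) //= eqxx mulr1 big1 ?addr0 // => j.
by rewrite -val_eqE /= => /negPf->; rewrite mulr0.
Qed.

(** * The insertion of free colours *)

Section InsertionOfFreeColours.

Variables (R : comNzRingType) (q : R) (n : nat).
Hypothesis reg : forall L, GRing.lreg (1 - q ^+ L.+1).

(* [e L i k] is attached to the next colour a_i b_k; a_y b_z is the last bound
   colour and [r] the series for the bound colours before it. *)
Definition insertion_rec (gap : nat -> nat -> nat -> nat -> nat) (y z : nat)
    (e : nat -> nat -> nat -> R) (r : nat -> R) :=
  forall L i k, (i < n)%N -> (k < n)%N ->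
  (1 - q ^+ L.+1) * e L.+1 i k
  = \sum_(j < n) (q ^+ L.+1) ^+ gap j j i k * e L j j
    + (q ^+ L.+1) ^+ gap y z i k * r L.

(** Subtract the recurrence at a_i b_i from the one at a_i b_k and cancel the regular factor 1 -
    q^(L+1). *)
Lemma insertion_diff gap y z e r c d L i k :
    insertion_rec gap y z e r -> (i < n)%N -> (k < n)%N ->
    (forall j, (q ^+ L.+1) ^+ gap j j i k - (q ^+ L.+1) ^+ gap j j i i
               = (1 - q ^+ L.+1) * c j) ->
    (q ^+ L.+1) ^+ gap y z i k - (q ^+ L.+1) ^+ gap y z i i
      = (1 - q ^+ L.+1) * d ->
  e L.+1 i k = e L.+1 i i + \sum_(j < n) c j * e L j j + d * r L.
Proof.
move=> rec ltin ltkn cE dE; apply: (@reg L).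
rewrite !mulrDr !rec // mulrA -dE mulr_sumr.
have -> : \sum_(j < n) (1 - q ^+ L.+1) * (c j * e L j j) =
    \sum_(j < n) (q ^+ L.+1) ^+ gap j j i k * e L j j
    - \sum_(j < n) (q ^+ L.+1) ^+ gap j j i i * e L j j.
  by rewrite -sumrB; apply: eq_bigr => j _; rewrite mulrA -cE mulrBl.
by ring_pow.
Qed.

Variables (y z : nat) (e f : nat -> nat -> nat -> R) (r s : nat -> R) (e0 : R).
Hypothesis neq_yz : y != z.
Hypothesis eP : insertion_rec gapP y z e r.
Hypothesis fF : insertion_rec gapF y z f s.
Hypothesis eE0 : forall i k, e 0 i k = e0.
Hypothesis fE0 : forall i k, f 0 i k = e0.
(** The induction hypothesis over the bound colours: [r] and [s] belong to the sequence without a_y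
    b_z, with a_y b_z as next colour. *)
Hypothesis rE : forall L, r L = trb q (y < z)%N s L.
(** For the empty bound sequence [z] is a junk value that need not lie below [n]; [s] is then zero
    and so is [rho]. *)
Hypothesis z_small : forall L, (z < n)%N%:R * rho q (y < z)%N s L = rho q (y < z)%N s L.

Lemma bound_source_transform j L :
  \sum_(k < L.+1) q ^+ (L - k) * qbin q L.+1 k.+1 *
      ((q ^+ k.+1) ^+ gapF y z j j * s k)
  = (q ^+ L.+1) ^+ gapF y z j j * trb q (y < z)%N s L
    + q ^+ L.+1 * rho q (y < z)%N s L.
Proof.
(* The gap is 0 exactly if y < j < z, and 2 exactly if z <= j <= y. The three values call for
   [tr1_rho], [tr1_rev] and [rhoS] respectively. *)
have : [\/ gapF y z j j = 1, gapF y z j j = 0 /\ (y < z)%N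
          | gapF y z j j = 2 /\ (z < y)%N]%N.
  rewrite /gapF; case: (ltngtP y z) neq_yz => // ltyz _;
    case: (leqP j y); case: (leqP z j) => ? ?;
    by [constructor 1 | constructor 2 | constructor 3 | exfalso; lia].
case=> [->|[-> ->]|[-> ltzy]].
- rewrite expr1 -mulrDr -tr1_rho mulr_sumr; apply: eq_bigr => k _.
  have lekL : (k <= L)%N by rewrite -ltnS.
  by rewrite (exprS_sub q lekL) expr1; ring_pow.
- rewrite mul1r -tr1_rev; apply: eq_bigr => k _.
  by rewrite expr0 mul1r.
rewrite ltnNge ltnW //= expr2 -mulrA -mulrDr addrC.
transitivity (q ^+ L.+1 * rho q false s L.+1); last by rewrite rhoS mul1n.
rewrite rhoE mulr_sumr; apply: eq_bigr => k _; rewrite /= mul1n.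
have lekL : (k <= L)%N by rewrite -ltnS.
by rewrite (exprS_sub q lekL) expr2; ring_pow.
Qed.

Lemma sum_tr1 (P : pred nat) L :
    (forall j, (j < n)%N -> e L j j = tr1 q (fun m => f m j j) L
                                      + (j == z)%:R * rho q (y < z)%N s L) ->
  \sum_(j < n) (P j)%:R * e L j j
  = \sum_(j < n) (P j)%:R * tr1 q (fun m => f m j j) L
    + (P z)%:R * rho q (y < z)%N s L.
Proof.
move=> eE; under eq_bigr => j _ do rewrite eE // mulrDr.
rewrite big_split; congr (_ + _) => /=.
under eq_bigr => j _ do rewrite mulrA.
by rewrite -mulr_suml sum_delta andbC -mulnb natrM -mulrA z_small.
Qed.

(** Induction on [L]: after multiplication by 1 - q^(L+1), [tr1S] exposes the recurrence of [f], and
    the induction hypothesis summed over all free colours matches it with the recurrence of [e]. *)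
Lemma free_transform L j : (j < n)%N ->
  e L j j = tr1 q (fun m => f m j j) L + (j == z)%:R * rho q (y < z)%N s L.
Proof.
elim: L j => [|L IH] j ltjn.
  by rewrite rho0 mulr0 addr0 eE0 /tr1 big_ord1 qbinn mul1r fE0.
apply: (@reg L); rewrite eP // rE mulrDr tr1S.
(* With x = q^(m+1), the gap 2 from a_j b_j to itself contributes x^2, and the added term
   contributes x - x^2. All free colours thus enter with the same factor x. *)
have fS m : (1 - q ^+ m.+1) * (f m.+1 j j + q ^+ m.+1 * f m j j)
    = q ^+ m.+1 * \sum_(i < n) f m i i + (q ^+ m.+1) ^+ gapF y z j j * s m.
  rewrite mulrDr fF // addrAC; congr (_ + _); move: (q ^+ m.+1) => x.
  rewrite (bigD1 (Ordinal ltjn)) //= [in RHS](bigD1 (Ordinal ltjn)) //=.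
  rewrite gapF_free eqxx /= expr2 [in RHS]mulrDr [in RHS]mulr_sumr.
  under eq_bigr => i ne_ij.
    rewrite gapF_free (_ : (i == j :> nat) = false) ?expr1; last exact: negPf.
    over.
  by ring.
under [in RHS]eq_bigr => m _ do rewrite fS.
have -> : \sum_(k < L.+1) q ^+ (L - k) * qbin q L.+1 k.+1 *
      (q ^+ k.+1 * \sum_(i < n) f k i i + (q ^+ k.+1) ^+ gapF y z j j * s k)
    = q ^+ L.+1 * \sum_(i < n) tr1 q (fun m => f m i i) L
      + \sum_(k < L.+1) q ^+ (L - k) * qbin q L.+1 k.+1 *
          ((q ^+ k.+1) ^+ gapF y z j j * s k).
  rewrite [X in _ * X]exchange_big mulr_sumr -big_split; apply: eq_bigr => k _ /=.
  have lekL : (k <= L)%N by rewrite -ltnS.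
  by rewrite -mulr_sumr (exprS_sub q lekL); ring_pow.
rewrite bound_source_transform //.
(* For [gapP] the gap from a_j b_j to itself is 0, and 1 = x + (1 - x) again isolates a uniform
   factor x. *)
have -> : \sum_(i < n) (q ^+ L.+1) ^+ gapP i i j j * e L i i
    = q ^+ L.+1 * \sum_(i < n) e L i i + (1 - q ^+ L.+1) * e L j j.
  move: (q ^+ L.+1) => x.
  rewrite (bigD1 (Ordinal ltjn)) //= [in RHS](bigD1 (Ordinal ltjn)) //=.
  rewrite gapP_free eqxx /= expr0 [in RHS]mulrDr [in RHS]mulr_sumr.
  under eq_bigr => i ne_ij.
    rewrite gapP_free (_ : (i != j :> nat) = true) ?expr1 //.
    over.
  by ring.
have := @sum_tr1 predT L (@IH).
under eq_bigr => i _ do rewrite mul1r.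
under [in RHS]eq_bigr => i _ do rewrite mul1r.
rewrite mul1r => ->; rewrite IH // gapP_bound_free // rhoS.
by rewrite [(~~ _ * _)%N]mulnC exprM; ring_pow.
Qed.

Lemma bound_source_rho i L :
  \sum_(m < L.+1) qbin q L.+1 m.+1 * ((q ^+ m.+1) ^+ (i <= y)%N * s m)
  = rho q (y < i)%N s L.+1.
Proof.
rewrite rhoE; apply: eq_bigr => m _; rewrite -leqNgt.
by case: (i <= y)%N; rewrite ?mul1n ?mul0n; ring_pow.
Qed.

Lemma bound_source_rev i L : (i < z)%N ->
  \sum_(m < L.+1) q ^+ (L - m) * qbin q L.+1 m.+1 *
      ((q ^+ m.+1) ^+ (i <= y)%N * s m)
  = q ^+ L.+1 * rho q (y < z)%N s L
    + (q ^+ L.+1) ^+ (i <= y)%N * trb q (y < z)%N s L.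
Proof.
move=> ltiz; case: (leqP i y) => [leiy|ltyi] /=.
  rewrite expr1 addrC -mulrDr -tr1_rho mulr_sumr; apply: eq_bigr => m _.
  have lemL : (m <= L)%N by rewrite -ltnS.
  by rewrite (exprS_sub q lemL); ring_pow.
rewrite (ltn_trans ltyi ltiz) mul1r addrC -tr1_rev.
by apply: eq_bigr => m _; rewrite mul1r.
Qed.

Lemma sum_free_tr1 (P : pred nat) L :
  \sum_(m < L.+1) qbin q L.+1 m.+1 * \sum_(j < n) (P j)%:R * f m j j
  = \sum_(j < n) (P j)%:R * tr1 q (fun m => f m j j) L.
Proof.
under eq_bigr => m _ do rewrite mulr_sumr.
rewrite exchange_big; apply: eq_bigr => j _; rewrite mulr_sumr.
by apply: eq_bigr => m _; rewrite mulrCA.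
Qed.

(** [insertion_diff] expresses both series at a_i b_k through those at free colours and the last
    bound colour; [free_transform] and [rE] then convert the terms for [e] into those for [f]. *)
Lemma bound_transform_gt L i k : (i < n)%N -> (k < n)%N -> (k < i)%N ->
  e L.+1 i k = trb q false (fun m => f m i k) L.+1.
Proof.
move=> ltin ltkn ltki.
have fS m : f m.+1 i k = f m.+1 i i + q ^+ m.+1 * f m i i
    + \sum_(j < n) (k < j < i)%N%:R * f m j j
    + (k < z <= i)%N%:R * ((q ^+ m.+1) ^+ (i <= y)%N * s m).
  rewrite (insertion_diff fF ltin ltkn (fun j => gapF_gt _ j ltki)
             (gapF_bound_gt _ y z ltki)) mulrA; congr (_ + _); rewrite -addrA.
  congr (_ + _); under eq_bigr => j _ do rewrite mulrDl.
  rewrite big_split addrC; congr (_ + _) => /=.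
  rewrite (bigD1 (Ordinal ltin)) //= eqxx mulr1 big1 ?addr0 // => j.
  by rewrite -val_eqE /= => /negPf->; rewrite mulr0 mul0r.
(* The terms in [f m.+1 i i] rebuild [trb] and the terms in q^(m+1) [f m i i] rebuild [rho];
   together they form [tr1]. *)
have -> : trb q false (fun m => f m i k) L.+1
  = tr1 q (fun m => f m i i) L.+1
    + \sum_(j < n) (k < j < i)%N%:R * tr1 q (fun m => f m j j) L
    + (k < z <= i)%N%:R * rho q (y < i)%N s L.+1.
  rewrite (tr1_rho q false) !trb_recl !fE0 rhoE.
  rewrite -(sum_free_tr1 (fun j => (k < j < i)%N)) -bound_source_rho.
  rewrite mulr_sumr -!addrA; congr (_ + _); rewrite -!big_split.
  by apply: eq_bigr => m _; rewrite fS /= mul1n mul0n; ring_pow.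
rewrite (insertion_diff eP ltin ltkn (fun j => gapP_gt _ j ltki)
           (gapP_bound_gt _ neq_yz ltki)).
have /= -> := @sum_tr1 (fun j => (k < j < i)%N) L (@free_transform L).
rewrite free_transform // rE.
(* For z = i the contribution of the last bound colour is the [rho] term of [free_transform] at a_i
   b_i; for k < z < i it combines the [rho] term from the sum over free colours with [r L]. *)
case: (ltngtP z i) => [ltzi|ltiz|eqzi].
- rewrite mul0r addr0 andbT -!addrA; do 2 congr (_ + _).
  case: (k < z)%N; last by rewrite !mul0r addr0.
  case: (leqP i y) => [leiy|ltyi]; rewrite !mul1r /=.
    by rewrite [(y < z)%N]ltnNge (leq_trans (ltnW ltzi) leiy) rhoS mul1n expr1.
  by rewrite addrC -tr1_rho rhoS (tr1_rho _ true) mul1r addrC.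
- by rewrite andbF !mul0r !addr0.
- by rewrite eqzi ltki andbF !mul0r !mul1r !addr0 addrAC.
Qed.

Lemma bound_transform_lt L i k : (i < n)%N -> (k < n)%N -> (i < k)%N ->
  e L.+1 i k = trb q true (fun m => f m i k) L.+1.
Proof.
move=> ltin ltkn ltik.
have fS m : f m.+1 i k = f m.+1 i i
    - q ^+ m.+1 * (\sum_(j < n) (i < j <= k)%N%:R * f m j j)
    - (i < z <= k)%N%:R * ((q ^+ m.+1) ^+ (i <= y)%N * s m).
  rewrite (insertion_diff fF ltin ltkn (fun j => gapF_lt _ j ltik)
             (gapF_bound_lt _ y z ltik)) mulNr mulrA; congr (_ + _ - _).
  by rewrite mulr_sumr -sumrN; apply: eq_bigr => j _; rewrite mulNr mulrA.
rewrite trb_recl fE0.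
have -> : \sum_(m < L.+1) q ^+ (true * (L - m)) * qbin q L.+1 m.+1 * f m.+1 i k
  = \sum_(m < L.+1) q ^+ (true * (L - m)) * qbin q L.+1 m.+1 * f m.+1 i i
    - q ^+ L.+1 * \sum_(j < n) (i < j <= k)%N%:R * tr1 q (fun m => f m j j) L
    - (i < z <= k)%N%:R * \sum_(m < L.+1) q ^+ (L - m) * qbin q L.+1 m.+1
         * ((q ^+ m.+1) ^+ (i <= y)%N * s m).
  rewrite -(sum_free_tr1 (fun j => (i < j <= k)%N)) !mulr_sumr -!sumrB.
  apply: eq_bigr => m _.
  have lemL : (m <= L)%N by rewrite -ltnS.
  by rewrite fS mul1n (exprS_sub q lemL); ring_pow.
(* Since [trb] is [tr1] minus [rho], and [rho true] grows by [trb true], the value of [trb true] at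
   [L.+1] is the increment of [tr1] from [L] to [L.+1]. The term [e0] is the summand of index 0. *)
have -> : \sum_(m < L.+1) q ^+ (true * (L - m)) * qbin q L.+1 m.+1 * f m.+1 i i
    = tr1 q (fun m => f m i i) L.+1 - tr1 q (fun m => f m i i) L
      - q ^+ (true * L.+1) * e0.
  rewrite (tr1_rho q true _ L.+1) rhoS (tr1_rho q true _ L) trb_recl fE0.
  by rewrite mul0n expr0; ring_pow.
rewrite (insertion_diff eP ltin ltkn (fun j => gapP_lt _ j ltik)
           (gapP_bound_lt _ neq_yz ltik)).
have -> : \sum_(j < n) - ((j == i :> nat)%:R + q ^+ L.+1 * (i < j <= k)%N%:R) * e L j j
    = - e L i i - q ^+ L.+1 * \sum_(j < n) (i < j <= k)%N%:R * e L j j.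
  under eq_bigr => j _ do rewrite mulNr mulrDl opprD.
  rewrite big_split /=; congr (_ + _).
    rewrite (bigD1 (Ordinal ltin)) //= eqxx mul1r big1 ?addr0 // => j.
    by rewrite -val_eqE /= => /negPf->; rewrite mul0r oppr0.
  by rewrite mulr_sumr -sumrN; apply: eq_bigr => j _; rewrite mulrA.
have /= -> := @sum_tr1 (fun j => (i < j <= k)%N) L (@free_transform L).
rewrite !free_transform // rE rhoS.
case: (ltngtP i z) => [ltiz|ltzi|eqiz] /=.
- case: (z <= k)%N; last by rewrite !mul0r; ring_pow.
  by rewrite bound_source_rev //; ring_pow.
- by ring_pow.
- rewrite -eqiz (ltnW ltik) -leqNgt.
  case: (i <= y)%N; rewrite /= ?mul1n ?mul0n ?expr0 ?expr1 ?mul0r ?mul1r;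
    by rewrite ?subr0 ?addr0; ring_pow.
Qed.

Lemma bound_transform L i k : (i < n)%N -> (k < n)%N -> i != k ->
  e L i k = trb q (i < k)%N (fun m => f m i k) L.
Proof.
case: L => [|L] ltin ltkn.
  by rewrite /trb big_ord1 qbin0 subnn muln0 expr0 !mul1r eE0 fE0.
case: (ltngtP i k) => // ltik _; first exact: bound_transform_lt.
exact: bound_transform_gt.
Qed.

(** The [rho] term left over by the free colours and the [trb] term of the bound colour add up to
    [tr1] of [s]. *)
Lemma total_transform L :
  \sum_(j < n) e L j j + r L = tr1 q (fun m => \sum_(j < n) f m j j + s m) L.
Proof.
have := @sum_tr1 predT L (@free_transform L).
under eq_bigr => i _ do rewrite mul1r.
under [in RHS]eq_bigr => i _ do rewrite mul1r.
rewrite mul1r => ->; rewrite rE -addrA [rho _ _ _ _ + _]addrC -tr1_rho.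
rewrite exchange_big -big_split; apply: eq_bigr => m _ /=.
by rewrite mulrDr mulr_sumr.
Qed.

End InsertionOfFreeColours.

(** * Generating functions of coloured words *)

Section NilpotentGeometric.

Variables (R : comNzRingType) (M : nat).

Lemma expr_nilp_ge (x : R) k : x ^+ M = 0 -> (M <= k)%N -> x ^+ k = 0.
Proof. by move=> xM0 leMk; rewrite -(subnK leMk) exprD xM0 mulr0. Qed.

Lemma geometric_nilp (x : R) d : x ^+ M = 0 ->
  (1 - x) * \sum_(0 <= a < M | (d <= a)%N) x ^+ a = x ^+ d.
Proof.
move=> xM0; have geom N : (1 - x) * \sum_(0 <= a < N | (d <= a)%N) x ^+ a
    = if (d <= N)%N then x ^+ d - x ^+ N else 0.
  elim: N => [|N IH].
    by rewrite big_geq // mulr0 leqn0; case: eqP => [->|//]; rewrite subrr.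
  rewrite big_mkcond big_nat_recr //= -big_mkcond mulrDr IH.
  case: (ltngtP d N.+1) => [|ltNd|->].
  - by rewrite ltnS => ->; rewrite exprS; ring_pow.
  - by rewrite leqNgt ltnW // mulr0 addr0.
  - by rewrite ltnn subrr mulr0 addr0.
rewrite geom xM0 subr0; case: leqP => // ltMd.
by rewrite (expr_nilp_ge xM0) // ltnW.
Qed.

Lemma nilp_lreg (x : R) : x ^+ M = 0 -> GRing.lreg (1 - x).
Proof.
move=> xM0 a b /(congr1 ( *%R (\sum_(0 <= a < M | (0 <= a)%N) x ^+ a))).
by rewrite !mulrA ![_ * (1 - x)]mulrC geometric_nilp // !mul1r.
Qed.

(** The q-Pochhammer symbol (q; q)_k. *)
Definition qfact (q : R) k := \prod_(i < k) (1 - q ^+ i.+1).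

Lemma qfactS q k : qfact q k.+1 = qfact q k * (1 - q ^+ k.+1).
Proof. exact: big_ord_recr. Qed.

(** Induction on [k]. Shifting [L] by one loses only a multiple of q^M = 0, and the Pascal rule then
    gives a linear equation for the sum. *)
Lemma sum_qbin_nilp (q : R) k : q ^+ M = 0 ->
  qfact q k.+1 * \sum_(L < M) q ^+ L * qbin q L k = q ^+ k.
Proof.
move=> qM0; elim: k => [|k IH].
  rewrite qfactS /qfact big_ord0 mul1r expr1 -[RHS](@geometric_nilp q 0) //.
  by rewrite big_mkord; congr (_ * _); apply: eq_bigr => L _; rewrite qbin0 mulr1.
rewrite qfactS -mulrA [X in _ * X](_ : _ = q * \sum_(L < M) q ^+ L * qbin q L k).
  by rewrite mulrCA IH exprS.
suff eqS : \sum_(L < M) q ^+ L * qbin q L k.+1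
    = q * \sum_(L < M) q ^+ L * qbin q L k
      + q ^+ k.+2 * \sum_(L < M) q ^+ L * qbin q L k.+1.
  by rewrite mulrBl mul1r {1}eqS addrK.
rewrite !mulr_sumr -big_split /=.
transitivity (\sum_(L < M.+1) q ^+ L * qbin q L k.+1).
  by rewrite big_ord_recr /= qM0 mul0r addr0.
rewrite big_ord_recl qbin_small // mulr0 add0r; apply: eq_bigr => L _.
by rewrite /= /bump add1n qbinS !exprS; ring_pow.
Qed.

End NilpotentGeometric.

Section Words.

Variables (X : eqType) (A : seq X).

Fixpoint words L : seq (seq X) :=
  if L is L'.+1 then [seq x :: s | x <- A, s <- words L'] else [:: [::]].

Lemma mem_words L s : (s \in words L) = (size s == L) && all (mem A) s.
Proof.
elim: L s => [|L IH] [|x s] //=; first by apply/allpairsP => -[[]] ? ? [].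
apply/allpairsP/idP => [[[y t] /= [yA tw [-> ->]]]|].
  by move: tw; rewrite IH eqSS => /andP[-> ->]; rewrite yA.
rewrite eqSS => /andP[sL /andP[xA sA]]; exists (x, s); split=> //.
by rewrite IH sL.
Qed.

Lemma words_uniq L : uniq A -> uniq (words L).
Proof.
move=> uA; elim: L => //= L IH; apply: allpairs_uniq => // -[x s] [y t] _ _ /=.
by case=> -> ->.
Qed.

Definition all_words N := [seq s | L <- iota 0 N, s <- words L].

Lemma mem_all_words N s : (s \in all_words N) = (size s < N)%N && all (mem A) s.
Proof.
apply/allpairsPdep/idP => [[L [t [LN tL ->]]]|/andP[sN sA]].
  move: LN tL; rewrite mem_iota mem_words add0n => /= ltLN /andP[/eqP-> ->].
  by rewrite ltLN.
by exists (size s), s; rewrite mem_iota mem_words eqxx.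
Qed.

Lemma all_words_uniq N : uniq A -> uniq (all_words N).
Proof.
move=> uA; apply: allpairs_uniq_dep => [|L _|]; first exact: iota_uniq.
  exact: words_uniq.
move=> _ _ /allpairsPdep[L [s [_ + ->]]] /allpairsPdep[L' [t [_ + ->]]] /=.
by rewrite !mem_words => /andP[/eqP <- _] /andP[/eqP <- _] ->.
Qed.

Lemma sum_all_words (V : nmodType) N (p : pred (seq X)) (F : seq X -> V) :
  \sum_(s <- all_words N | p s) F s
  = \sum_(L < N) \sum_(s <- words L | p s) F s.
Proof.
rewrite big_mkcond big_allpairs_dep -{1}[N]subn0 -/(index_iota 0 N) big_mkord.
by apply: eq_bigr => L _; rewrite -big_mkcond.
Qed.

End Words.

(* Words are read backwards, from the last part to the first one, so that
   [rel x y] says that [y] may precede [x]. *)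
Section ColouredWords.

Variables (R : comNzRingType) (q : R) (n : nat).
Variables (X : eqType) (A : seq X) (col : X -> colour n) (w : X -> nat).
Variables (rel : rel X) (gap : colour n -> colour n -> nat) (o : colour n -> X).
Variables (D : nat -> R) (init : pred X) (ini : nat -> R).
Implicit Types (b : seq (colour n)) (s : seq X) (x y : X) (c t : colour n).

Hypothesis colo : forall c, col (o c) = c.
Hypothesis wo : forall c, w (o c) = 0%N.
Hypothesis D_reg : forall L, GRing.lreg (D L).
(** The letters of colour [t] that may precede [x] form a geometric series (a product of two for
    columns), whose denominator is [D L]. *)
Hypothesis sum_rel : forall L x t,
  D L * \sum_(y <- A | rel x y && (col y == t)) q ^+ (L.+1 * w y)
  = q ^+ (L.+1 * (w x + gap t (col x))).
Hypothesis sum_init : forall L t,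
  D L * \sum_(y <- A | init y && (col y == t)) q ^+ (L.+1 * w y) = ini L.

Definition bound_colours s := [seq c <- map col s | is_bound c].

Definition word_weight s := sumn (map w s).

Definition path_gf L b x :=
  \sum_(s <- words A L | path rel x s && (bound_colours s == b))
     q ^+ word_weight s.

Definition init_path s := if s is x :: s' then init x && path rel x s' else true.

Definition word_gf L b :=
  \sum_(s <- words A L | init_path s && (bound_colours s == b))
     q ^+ word_weight s.

(** The effect of a letter of colour [t] at the head of a word: a free colour leaves the bound
    sequence [b] alone, a bound one must be its head and is removed. *)
Definition step t b (F : seq (colour n) -> R) : R :=
  if is_bound t then (if b is t' :: b' then (t == t')%:R * F b' else 0) else F b.

Lemma step_scale t b (a : R) F : step t b (fun b' => a * F b') = a * step t b F.
Proof. by rewrite /step; case: is_bound => //; case: b => [|? ?]; ring. Qed.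

Lemma eq_step t b F G : F =1 G -> step t b F = step t b G.
Proof.
by move=> eqFG; rewrite /step; case: is_bound => //; case: b => // ? ?; rewrite eqFG.
Qed.

Lemma sum_cons L b (P : pred X) (Q : X -> pred (seq X)) :
  \sum_(s <- words A L.+1 | (if s is y :: s' then P y && Q y s' else true)
                            && (bound_colours s == b))
     q ^+ word_weight s
  = \sum_(y <- A | P y) q ^+ w y * step (col y) b (fun b' =>
      \sum_(s <- words A L | Q y s && (bound_colours s == b')) q ^+ word_weight s).
Proof.
rewrite big_mkcond big_allpairs_dep [RHS]big_mkcond; apply: eq_bigr => y _.
case: (P y) => /=; last by rewrite big1.
rewrite -big_mkcond /= /step /bound_colours /=; case: ifP => _; last first.
  rewrite mulr_sumr; apply: eq_bigr => s _.
  by rewrite /word_weight /= exprD.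
case: b => [|t' b'].
  by rewrite mulr0 big_pred0 // => s; rewrite andbF.
rewrite mulr_sumr mulr_sumr [LHS]big_mkcond [RHS]big_mkcond; apply: eq_bigr => s _.
rewrite eqseq_cons /word_weight /= exprD.
by case: (col y == t'); case: (Q y s); case: (_ == b') => //=; ring_pow.
Qed.

Lemma path_gfS L b x : path_gf L.+1 b x =
  \sum_(y <- A | rel x y) q ^+ w y * step (col y) b (fun b' => path_gf L b' y).
Proof.
rewrite -(sum_cons L b (rel x) (fun y s => path rel y s)).
by apply: eq_bigl => -[].
Qed.

Lemma word_gfS L b : word_gf L.+1 b =
  \sum_(y <- A | init y) q ^+ w y * step (col y) b (fun b' => path_gf L b' y).
Proof. exact: (sum_cons L b init (fun y s => path rel y s)). Qed.

Lemma path_gf0 b x : path_gf 0 b x = (b == [::])%:R.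
Proof. by rewrite /path_gf /= big_mkcond big_seq1 eq_sym; case: eqP. Qed.

Lemma word_gf0 b : word_gf 0 b = (b == [::])%:R.
Proof. by rewrite /word_gf /= big_mkcond big_seq1 eq_sym; case: eqP. Qed.

Lemma sum_step L b (P : pred X) (h : colour n -> R) :
    (forall b' y, path_gf L b' y = q ^+ (L * w y) * path_gf L b' (o (col y))) ->
    (forall t, D L * \sum_(y <- A | P y && (col y == t)) q ^+ (L.+1 * w y) = h t) ->
  D L * \sum_(y <- A | P y) q ^+ w y * step (col y) b (fun b' => path_gf L b' y)
  = \sum_t h t * step t b (fun b' => path_gf L b' (o t)).
Proof.
move=> shift hE; rewrite (partition_big col predT) //= mulr_sumr.
apply: eq_bigr => t _; rewrite -hE -mulrA mulr_suml; congr (_ * _).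
apply: eq_bigr => y /andP[_ /eqP <-].
rewrite (eq_step _ _ (fun b' => shift b' y)) step_scale mulrA.
by rewrite -exprD mulSn.
Qed.

(** Raising the letter [x] by its weight raises each of the [L] letters before it. On a truncated
    alphabet this is no bijection, so it is derived from the recurrence by cancelling [D L]. *)
Lemma path_gf_shift L b x :
  path_gf L b x = q ^+ (L * w x) * path_gf L b (o (col x)).
Proof.
elim: L b x => [|L IH] b x; first by rewrite !path_gf0 mul1r.
have key z : D L * path_gf L.+1 b z = q ^+ (L.+1 * w z) *
    \sum_t q ^+ (L.+1 * gap t (col z)) * step t b (fun b' => path_gf L b' (o t)).
  rewrite path_gfS (sum_step b IH (fun t => sum_rel L z t)) mulr_sumr.
  by apply: eq_bigr => t _; rewrite mulnDr exprD mulrA.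
apply: (@D_reg L); by rewrite key mulrCA key colo wo muln0 mul1r.
Qed.

Definition tail_gf L b c := path_gf L b (o c).

Lemma tail_gfS L b c : D L * tail_gf L.+1 b c =
  \sum_t (q ^+ L.+1) ^+ gap t c * step t b (fun b' => tail_gf L b' t).
Proof.
rewrite /tail_gf path_gfS.
rewrite (sum_step b (path_gf_shift L) (fun t => sum_rel L (o c) t)).
by apply: eq_bigr => t _; rewrite wo colo add0n exprM.
Qed.

Lemma word_gfE L b : D L * word_gf L.+1 b =
  ini L * \sum_t step t b (fun b' => tail_gf L b' t).
Proof.
by rewrite word_gfS (sum_step b (path_gf_shift L) (sum_init L)) mulr_sumr.
Qed.

Lemma sum_over_step b (h : colour n -> R) (F : seq (colour n) -> colour n -> R) :
    all (@is_bound n) b ->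
  \sum_t h t * step t b (F^~ t)
  = \sum_(j < n) h (j, j) * F b (j, j)
    + (if b is t :: b' then h t * F b' t else 0).
Proof.
move=> bB; rewrite (bigID (@is_free n)) /=; congr (_ + _).
  rewrite (reindex_onto (fun j => (j, j)) fst) /=; last first.
    by case=> i k /eqP /= ->.
  apply: eq_big => [j|j _]; first by rewrite /is_free /= !eqxx.
  by rewrite /step /is_bound /is_free /= eqxx.
case: b bB => [|t b] /= => [_|/andP[tB _]].
  by rewrite big1 // => t tB; rewrite /step [is_bound t]tB mulr0.
rewrite (bigD1 t) //= big1 => [|t' /andP[t'B /negPf ne_t't]].
  by rewrite /step tB eqxx mul1r addr0.
by rewrite /step [is_bound t']t'B ne_t't mul0r mulr0.
Qed.

End ColouredWords.

Section Boxes.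

Variables (M : nat) (T : finType).

Definition boxes : seq (nat * T) := [seq (a, t) | a <- iota 0 M, t <- enum T].

Lemma mem_boxes x : (x \in boxes) = (x.1 < M)%N.
Proof.
case: x => a t; apply/allpairsP/idP => [[[b u] /= [+ _ [-> _]]]|aM].
  by rewrite mem_iota.
by exists (a, t); rewrite mem_iota mem_enum.
Qed.

Lemma boxes_uniq : uniq boxes.
Proof.
by apply: allpairs_uniq; rewrite ?iota_uniq ?enum_uniq // => -[? ?] [? ?] _ _ [-> ->].
Qed.

Lemma sum_boxes (V : nmodType) (P : pred (nat * T)) t (F : nat -> V) :
  \sum_(y <- boxes | P y && (y.2 == t)) F y.1
  = \sum_(0 <= a < M | P (a, t)) F a.
Proof.
rewrite big_mkcond big_allpairs [RHS]big_mkcond /index_iota subn0.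
apply: eq_bigr => a _; rewrite big_enum /= (bigD1 t) //= eqxx andbT.
by rewrite big1 ?addr0 // => u /negPf->; rewrite andbF.
Qed.

End Boxes.

(** * Partitions and arrays as words *)

Section Models.

Variables (R : comNzRingType) (q : R) (M n : nat).
Hypothesis qM0 : q ^+ M = 0.

Lemma expr_nilp L : (q ^+ L.+1) ^+ M = 0.
Proof. by rewrite -exprM mulnC exprM qM0 expr0n. Qed.

Let reg L : GRing.lreg (1 - q ^+ L.+1) := nilp_lreg (expr_nilp L).

(** Each subtracted [chi] in [Delta] is 1 only if the one before it is, so the gap is a natural
    number. *)
Lemma DeltaE (c c' : colour n) :
  Delta c c' = Posz (gapP c.1 c.2 c'.1 c'.2).
Proof.
case: c c' => [i k] [i' k']; rewrite /Delta /gapP /chi /= -!(inj_eq val_inj) /=.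
by case: (ltngtP i k); case: (ltngtP k i'); case: (ltngtP i' i);
  case: (ltngtP i' k'); case: (ltngtP k k'); rewrite /=; lia.
Qed.

Definition part_letters := boxes M (colour n).
Definition part_rel (x y : nat * colour n) := Delta y.2 x.2 <= Posz y.1 - Posz x.1.
Definition colour_gapP (c c' : colour n) := gapP c.1 c.2 c'.1 c'.2.

Lemma part_relE x y : part_rel x y = (x.1 + colour_gapP y.2 x.2 <= y.1)%N.
Proof. by rewrite /part_rel DeltaE /colour_gapP lerBrDr -PoszD lez_nat addnC. Qed.

Lemma sum_part_rel L x t :
  (1 - q ^+ L.+1) * \sum_(y <- part_letters | part_rel x y && (y.2 == t))
     q ^+ (L.+1 * y.1)
  = q ^+ (L.+1 * (x.1 + colour_gapP t x.2)).
Proof.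
rewrite (sum_boxes M (part_rel x) t (fun a => q ^+ (L.+1 * a))).
rewrite [in RHS]exprM -(geometric_nilp _ (expr_nilp L)); congr (_ * _).
by apply: eq_big => a; [rewrite part_relE | rewrite exprM].
Qed.

Lemma sum_part_init L (t : colour n) :
  (1 - q ^+ L.+1) * \sum_(y <- part_letters | (0 < y.1)%N && (y.2 == t))
     q ^+ (L.+1 * y.1)
  = q ^+ L.+1.
Proof.
rewrite (sum_boxes M (fun y => 0 < y.1)%N t (fun a => q ^+ (L.+1 * a))).
rewrite -[RHS]expr1 -(geometric_nilp _ (expr_nilp L)); congr (_ * _).
by apply: eq_bigr => a _; rewrite exprM.
Qed.

Definition column := ((nat * 'I_n) * (nat * 'I_n))%type.
Definition column_letters : seq column :=
  [seq (x, y) | x <- boxes M 'I_n, y <- boxes M 'I_n].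
Definition column_colour (x : column) : colour n := (x.1.2, x.2.2).
Definition column_weight (x : column) := (x.1.1 + x.2.1)%N.
Definition column_rel (x y : column) := lt_a x.1 y.1 && lt_b x.2 y.2.
Definition colour_gapF (c c' : colour n) := gapF c.1 c.2 c'.1 c'.2.
Definition column_start (c : colour n) : column := ((0%N, c.1), (0%N, c.2)).

Lemma column_startK c : column_colour (column_start c) = c.
Proof. by case: c. Qed.

Lemma lt_aE (x y : nat * 'I_n) : lt_a x y = (x.1 + (x.2 <= y.2) <= y.1)%N.
Proof. by rewrite /lt_a; case: (leqP x.2 y.2); case: (ltngtP x.1 y.1); lia. Qed.

Lemma lt_bE (x y : nat * 'I_n) : lt_b x y = (x.1 + (y.2 <= x.2) <= y.1)%N.
Proof. by rewrite /lt_b; case: (leqP y.2 x.2); case: (ltngtP x.1 y.1); lia. Qed.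

Lemma sum_columns (P Q : pred (nat * 'I_n)) (t : colour n) L :
  \sum_(y <- column_letters | (P y.1 && Q y.2) && (column_colour y == t))
     q ^+ (L * column_weight y)
  = (\sum_(0 <= a < M | P (a, t.1)) (q ^+ L) ^+ a)
    * (\sum_(0 <= a < M | Q (a, t.2)) (q ^+ L) ^+ a).
Proof.
rewrite -(sum_boxes M P) -(sum_boxes M Q) big_mkcond big_allpairs.
rewrite [X in _ = X * _]big_mkcond mulr_suml; apply: eq_bigr => x _.
rewrite [X in _ = _ * X]big_mkcond mulr_sumr; apply: eq_bigr => y _ /=.
rewrite /column_weight /column_colour -pair_eqE /pair_eq /= mulnDr exprD !exprM.
case: (P x); case: (Q y); case: (_ == t.1); case: (_ == t.2) => //=;
  by rewrite ?mul0r ?mulr0.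
Qed.

Definition sqr_factor L : R := (1 - q ^+ L.+1) * (1 - q ^+ L.+1).

Lemma sqr_factor_reg L : GRing.lreg (sqr_factor L).
Proof. by apply: GRing.lregM. Qed.

(** The two rows give independent geometric series. Ties in the coloured orders turn into gaps 0 or
    1 by [lt_aE] and [lt_bE], and their sum is [gapF]. *)
Lemma sum_column_rel L x t :
  sqr_factor L * \sum_(y <- column_letters | column_rel x y && (column_colour y == t))
     q ^+ (L.+1 * column_weight y)
  = q ^+ (L.+1 * (column_weight x + colour_gapF t (column_colour x))).
Proof.
rewrite (sum_columns (lt_a x.1) (lt_b x.2)) mulrACA.
rewrite (_ : \sum_(0 <= a < M | lt_a _ _) _ = \sum_(0 <= a < M |
   (x.1.1 + (x.1.2 <= t.1) <= a)%N) (q ^+ L.+1) ^+ a).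
  rewrite (_ : \sum_(0 <= a < M | lt_b _ _) _ = \sum_(0 <= a < M |
     (x.2.1 + (t.2 <= x.2.2) <= a)%N) (q ^+ L.+1) ^+ a).
    rewrite !geometric_nilp ?expr_nilp // -exprD -exprM.
    by rewrite /column_weight /colour_gapF /gapF addnACA.
  by apply: eq_bigl => a; rewrite lt_bE.
by apply: eq_bigl => a; rewrite lt_aE.
Qed.

Lemma sum_column_init L (t : colour n) :
  sqr_factor L * \sum_(y <- column_letters | predT y && (column_colour y == t))
     q ^+ (L.+1 * column_weight y)
  = 1.
Proof.
rewrite (sum_columns predT predT) mulrACA.
rewrite (_ : \sum_(0 <= a < M | _) _
  = \sum_(0 <= a < M | (0 <= a)%N) (q ^+ L.+1) ^+ a) //.
by rewrite geometric_nilp ?expr_nilp // mulr1.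
Qed.

End Models.

(** * Comparison of partitions and arrays with a fixed bound sequence *)

Section Comparison.

Variables (R : comNzRingType) (q : R) (M n' : nat).
Hypothesis qM0 : q ^+ M = 0.
Local Notation n := n'.+1.
Implicit Types (b : seq (colour n)) (c t : colour n).

Let reg L : GRing.lreg (1 - q ^+ L.+1) := nilp_lreg (expr_nilp qM0 L).

Definition part_gf := tail_gf q (part_letters M n) snd fst (@part_rel n) (pair 0%N).

Definition column_gf := tail_gf q (column_letters M n) (@column_colour n)
  (@column_weight n) (@column_rel n) (@column_start n).

(* Clearing one of the two factors 1/(q; q)_L leaves the series for the sums
   lambda_j + mu_j + 1. *)
Definition scaled_column_gf L b c := qfact q L * column_gf L b c.

Definition head_gf (g : nat -> seq (colour n) -> colour n -> R) b L : R :=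
  if b is t :: b' then g L b' t else 0.

Lemma part_gfS L b c : all (@is_bound n) b ->
  (1 - q ^+ L.+1) * part_gf L.+1 b c
  = \sum_(j < n) (q ^+ L.+1) ^+ colour_gapP (j, j) c * part_gf L b (j, j)
    + (if b is t :: b' then (q ^+ L.+1) ^+ colour_gapP t c * part_gf L b' t else 0).
Proof.
move=> bB; rewrite [LHS](@tail_gfS _ q n _ (part_letters M n) snd fst (@part_rel n)
  (@colour_gapP n) (pair 0%N) (fun L => 1 - q ^+ L.+1)
  (fun=> erefl) (fun=> erefl) reg (sum_part_rel qM0)).
exact: (sum_over_step (fun t => (q ^+ L.+1) ^+ colour_gapP t c) (part_gf L) bB).
Qed.

Lemma scaled_column_gfS L b c : all (@is_bound n) b ->
  (1 - q ^+ L.+1) * scaled_column_gf L.+1 b c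
  = \sum_(j < n) (q ^+ L.+1) ^+ colour_gapF (j, j) c * scaled_column_gf L b (j, j)
    + (if b is t :: b'
       then (q ^+ L.+1) ^+ colour_gapF t c * scaled_column_gf L b' t else 0).
Proof.
move=> bB; rewrite /scaled_column_gf qfactS.
transitivity (qfact q L * (sqr_factor q L * column_gf L.+1 b c)).
  by rewrite /sqr_factor; ring_pow.
rewrite (@tail_gfS _ q n _ (column_letters M n) (@column_colour n)
  (@column_weight n) (@column_rel n) (@colour_gapF n) (@column_start n)
  (sqr_factor q) (@column_startK n) (fun=> erefl) (sqr_factor_reg qM0)
  (sum_column_rel qM0)).
rewrite (sum_over_step (fun t => (q ^+ L.+1) ^+ colour_gapF t c) (column_gf L) bB).
rewrite mulrDr mulr_sumr; congr (_ + _).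
  by apply: eq_bigr => j _; rewrite mulrCA.
by case: b bB => [|t b] _; rewrite ?mulr0 // mulrCA.
Qed.

Definition nat_gf (g : nat -> seq (colour n) -> colour n -> R) b L (i k : nat) :=
  g L b (inord i, inord k).

(* The junk values (0, 1) keep the two indices distinct when [b] is empty. *)
Definition head_a b : nat := if b is t :: _ then t.1 else 0.
Definition head_b b : nat := if b is t :: _ then t.2 else 1.

Lemma insertion_rec_gf (gap : nat -> nat -> nat -> nat -> nat)
    (g : nat -> seq (colour n) -> colour n -> R) b :
    (forall L c, (1 - q ^+ L.+1) * g L.+1 b c
      = \sum_(j < n) (q ^+ L.+1) ^+ gap j j c.1 c.2 * g L b (j, j)
        + (if b is t :: b' then (q ^+ L.+1) ^+ gap t.1 t.2 c.1 c.2 * g L b' t else 0)) ->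
  insertion_rec q n gap (head_a b) (head_b b) (nat_gf g b) (head_gf g b).
Proof.
move=> gS L i k ltin ltkn; rewrite gS /= !inordK //; congr (_ + _).
  by apply: eq_bigr => j _; rewrite /nat_gf inord_val.
by case: b {gS} => [|t b] /=; rewrite ?mulr0.
Qed.

Lemma trb0 u L : trb q u (fun=> 0) L = 0.
Proof. by rewrite /trb big1 // => k _; rewrite mulr0. Qed.

Lemma rho_0 u L : rho q u (fun=> 0) L = 0.
Proof. by rewrite /rho big1 // => k _; rewrite mulr0. Qed.

Section OneBoundSequence.

Variable b : seq (colour n).
Hypothesis bB : all (@is_bound n) b.
Hypothesis head_transform : forall L, head_gf part_gf b L
  = trb q (head_a b < head_b b)%N (head_gf scaled_column_gf b) L.

Let neq_ab : head_a b != head_b b.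
Proof. by case: b bB => [|t b'] //= /andP[]. Qed.

Let recP := @insertion_rec_gf gapP part_gf b (fun L c => part_gfS L c bB).

Let recF := @insertion_rec_gf gapF scaled_column_gf b
  (fun L c => scaled_column_gfS L c bB).

Let partE0 i k : nat_gf part_gf b 0 i k = (b == [::])%:R.
Proof. exact: path_gf0. Qed.

Let columnE0 i k : nat_gf scaled_column_gf b 0 i k = (b == [::])%:R.
Proof. by rewrite /nat_gf /scaled_column_gf /qfact big_ord0 mul1r; apply: path_gf0. Qed.

Let b_small L : (head_b b < n)%N%:R
    * rho q (head_a b < head_b b)%N (head_gf scaled_column_gf b) L
  = rho q (head_a b < head_b b)%N (head_gf scaled_column_gf b) L.
Proof.
by case: b => [|t b'] /=; [rewrite rho_0 mulr0 | rewrite ltn_ord mul1r].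
Qed.

Lemma part_gf_transform L c : is_bound c ->
  part_gf L b c = trb q (c.1 < c.2)%N (fun m => scaled_column_gf m b c) L.
Proof.
move=> cB; have neq_c : c.1 != c.2 :> nat by [].
have := bound_transform reg neq_ab recP recF partE0 columnE0 head_transform
  b_small L (ltn_ord c.1) (ltn_ord c.2) neq_c.
by rewrite /nat_gf !inord_val -surjective_pairing.
Qed.

Lemma part_gf_total L :
  \sum_(j < n) part_gf L b (j, j) + head_gf part_gf b L
  = tr1 q (fun m => \sum_(j < n) scaled_column_gf m b (j, j)
                    + head_gf scaled_column_gf b m) L.
Proof.
have := total_transform reg neq_ab recP recF partE0 columnE0 head_transform
  b_small L.
rewrite /nat_gf; under eq_bigr => j _ do rewrite inord_val.
move=> ->; apply: eq_bigr => m _.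
by under eq_bigr => j _ do rewrite inord_val.
Qed.

End OneBoundSequence.

(** Induction on the bound sequence: [part_gf_transform] for the tail, taken at the colour [t], is
    the claim for [t :: b]. *)
Lemma head_transform b : all (@is_bound n) b -> forall L,
  head_gf part_gf b L
  = trb q (head_a b < head_b b)%N (head_gf scaled_column_gf b) L.
Proof.
elim: b => [|t b IH] /= => [_|/andP[tB bB]] L; first by rewrite trb0.
exact: part_gf_transform (IH bB) _ _ tB.
Qed.

Definition partition_gf := word_gf q (part_letters M n) snd fst (@part_rel n)
  (fun x => 0 < x.1)%N.

Definition array_gf := word_gf q (column_letters M n) (@column_colour n)
  (@column_weight n) (@column_rel n) predT.

Lemma partition_gfE L b : all (@is_bound n) b ->
  (1 - q ^+ L.+1) * partition_gf L.+1 b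
  = q ^+ L.+1 * (\sum_(j < n) part_gf L b (j, j) + head_gf part_gf b L).
Proof.
move=> bB; rewrite [LHS](@word_gfE _ q n _ (part_letters M n) snd fst (@part_rel n)
  (@colour_gapP n) (pair 0%N) (fun L => 1 - q ^+ L.+1) (fun x => 0 < x.1)%N
  (fun L => q ^+ L.+1) (fun=> erefl) (fun=> erefl) reg (sum_part_rel qM0)
  (sum_part_init qM0)).
congr (_ * _); have := sum_over_step (fun=> 1) (part_gf L) bB.
under eq_bigr => t _ do rewrite mul1r.
move=> ->; congr (_ + _); first by apply: eq_bigr => j _; rewrite mul1r.
by case: b {bB} => //= t b; rewrite mul1r.
Qed.

Lemma array_gfE L b : all (@is_bound n) b ->
  sqr_factor q L * array_gf L.+1 b
  = \sum_(j < n) column_gf L b (j, j) + head_gf column_gf b L.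
Proof.
move=> bB; rewrite [LHS](@word_gfE _ q n _ (column_letters M n) (@column_colour n)
  (@column_weight n) (@column_rel n) (@colour_gapF n) (@column_start n)
  (sqr_factor q) predT (fun=> 1) (@column_startK n) (fun=> erefl)
  (sqr_factor_reg qM0) (sum_column_rel qM0) (sum_column_init qM0)).
rewrite mul1r; have := sum_over_step (fun=> 1) (column_gf L) bB.
under eq_bigr => t _ do rewrite mul1r.
move=> ->; congr (_ + _); first by apply: eq_bigr => j _; rewrite mul1r.
by case: b {bB} => //= t b; rewrite mul1r.
Qed.

(** [part_gf_total] produces [L+1, k+1], and the absorption rule [qbinSS_mul] trades it for [L, k]
    so that 1 - q^(L+1) cancels. *)
Lemma partition_gf_transform L b : all (@is_bound n) b ->
  partition_gf L.+1 b
  = q ^+ L.+1 * \sum_(k < L.+1) qbin q L k * (qfact q k.+1 * array_gf k.+1 b).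
Proof.
move=> bB; apply: (@reg L).
rewrite partition_gfE // (part_gf_total bB (head_transform bB)) mulrCA.
congr (_ * _); rewrite mulr_sumr; apply: eq_bigr => k _.
rewrite mulrA -qbinSS_mul qfactS.
have -> : \sum_(j < n) scaled_column_gf k b (j, j) + head_gf scaled_column_gf b k
    = qfact q k * (sqr_factor q k * array_gf k.+1 b).
  rewrite array_gfE // mulrDr mulr_sumr; congr (_ + _).
  by case: b {bB} => [|t b] /=; rewrite ?mulr0.
by rewrite /sqr_factor; ring_pow.
Qed.

(** After exchanging the sums, [sum_qbin_nilp] collapses the sum over [L] to q^k; with the remaining
    factor q this is the weight q^(k+1) that the number of columns contributes. *)
Lemma sum_partition_gf b : all (@is_bound n) b ->
  \sum_(L < M.+1) partition_gf L b = \sum_(L < M.+1) q ^+ L * array_gf L b.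
Proof.
move=> bB; rewrite !big_ord_recl mul1r /partition_gf /array_gf !word_gf0.
congr (_ + _); rewrite -/partition_gf -/array_gf.
transitivity (\sum_(L < M) \sum_(k < M)
    q * (q ^+ L * qbin q L k * (qfact q k.+1 * array_gf k.+1 b))).
  apply: eq_bigr => L _; rewrite [LHS]partition_gf_transform // mulr_sumr.
  rewrite (big_ord_widen_cond M predT
    (fun k => q ^+ L.+1 * (qbin q L k * (qfact q k.+1 * array_gf k.+1 b)))) //.
  rewrite big_mkcond; apply: eq_bigr => k _ /=; rewrite ltnS.
  case: leqP => [_|ltLk]; first by rewrite exprS; ring_pow.
  by rewrite qbin_small // !(mulr0, mul0r).
rewrite exchange_big; apply: eq_bigr => k _ /=.
rewrite -mulr_sumr -mulr_suml [in RHS]/bump add1n exprS -mulrA.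
by rewrite -(sum_qbin_nilp k qM0); ring_pow.
Qed.

End Comparison.

(** The ring is Z[q]/(q^(m+1)), and [coef] reads off the coefficient of q^m. *)
Lemma truncated_power_series m :
  exists (R : comNzRingType) (q : R) (coef : R -> int),
    [/\ q ^+ m.+1 = 0, {morph coef : x y / x + y}, coef 0 = 0
      & forall k, coef (q ^+ k) = (k == m)%:R].
Proof.
pose h : {poly int} := 'X^(m.+1).
have hE : mk_monic h = 'X^(m.+1) by rewrite mk_monic_Xn.
have qX k : ('qX : {poly %/ h}) ^+ k = in_qpoly h 'X^k.
  by rewrite /qpolyX rmorphXn.
have qM0 : ('qX : {poly %/ h}) ^+ m.+1 = 0.
  by rewrite qX; apply/val_inj; rewrite /= hE Pdiv.RingMonic.rmodpp ?monicXn.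
exists ({poly %/ h} : comNzRingType), 'qX, (fun p : {poly %/ h} => (p : {poly int})`_m).
split=> // [x y||k]; [exact: coefD | exact: coef0 |].
case: (leqP k m) => [lekm|ltmk]; last first.
  by rewrite (expr_nilp_ge qM0) // gtn_eqF ?coef0.
by rewrite qX in_qpoly_small ?coefXn 1?eq_sym // hE !size_polyXn ltnS.
Qed.

(** * Counting *)

Section BoundSequences.

Variables (V : nmodType) (n : nat) (X : eqType) (A : seq X) (col : X -> colour n).

Lemma sum_bound_sequences N (I : pred (seq X)) (ok : pred (seq (colour n)))
    (F : seq X -> V) :
  \sum_(s <- all_words A N | I s && ok (bound_colours col s)) F s
  = \sum_(b <- all_words (enum {: colour n}) N | all (@is_bound n) b && ok b)
      \sum_(L < N) \sum_(s <- words A L | I s && (bound_colours col s == b)) F s.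
Proof.
under [RHS]eq_bigr => b _ do rewrite -sum_all_words.
rewrite (exchange_big_dep (fun s => I s && ok (bound_colours col s))) /=; last first.
  by move=> b s /andP[_ okb] /andP[-> /eqP->].
rewrite big_seq_cond [RHS]big_seq_cond; apply: eq_bigr => s.
rewrite mem_all_words => /andP[/andP[sN _] /andP[Is oks]].
have bin : bound_colours col s \in all_words (enum {: colour n}) N.
  rewrite mem_all_words; apply/andP; split.
    by rewrite (leq_ltn_trans _ sN) // size_filter -[leqRHS](size_map col) count_size.
  by apply/allP => c _; rewrite /= mem_enum.
rewrite -big_filter (_ : [seq b <- _ | _] = [:: bound_colours col s]) ?big_seq1 //.
rewrite -(filter_pred1_uniq (all_words_uniq N (enum_uniq {: colour n})) bin).
apply: eq_filter => b /=; rewrite Is /= eq_sym.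
by case: eqP => [->|]; rewrite ?andbF // oks filter_all.
Qed.

End BoundSequences.

Section Counting.

Variables (m n' : nat).
Local Notation n := n'.+1.
Local Notation parts := (all_words (part_letters m.+1 n) m.+2).
Local Notation columns := (all_words (column_letters m.+1 n) m.+2).
Local Notation is_part := (init_path (@part_rel n) (fun x => 0 < x.1)%N).
Local Notation is_array := (init_path (@column_rel n) predT).

Lemma count_parts_columns (ok : pred (seq (colour n))) :
  count (fun s => [&& is_part s, ok (bound_colours snd s)
                    & word_weight fst s == m]) parts
  = count (fun s => [&& is_array s, ok (bound_colours (@column_colour n) s)
                      & size s + word_weight (@column_weight n) s == m])%N columns.
Proof.
have [R [q [coef [qM0 coefD coef0 coefX]]]] := truncated_power_series m.
have countE (X : eqType) (U : seq X) (P : pred X) w :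
    (count (fun s => P s && (w s == m)) U)%:R
    = coef (\sum_(s <- U | P s) q ^+ w s) :> int.
  rewrite (big_morph coef coefD coef0) -sum1_count big_mkcond natr_sum.
  rewrite [RHS]big_mkcond; apply: eq_bigr => s _; rewrite coefX.
  by case: (P s); case: eqP.
apply/eqP; rewrite -(eqr_nat int); apply/eqP.
under eq_count => s do rewrite andbA.
under [in RHS]eq_count => s do rewrite andbA.
rewrite !countE !sum_bound_sequences; congr coef.
rewrite big_seq_cond [RHS]big_seq_cond; apply: eq_bigr => b.
case/and3P=> _ bB _; rewrite (sum_partition_gf qM0 bB).
apply: eq_bigr => L _; rewrite mulr_sumr.
rewrite big_seq_cond [RHS]big_seq_cond; apply: eq_bigr => s.
by rewrite mem_words exprD => /andP[/andP[/eqP-> _] _].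
Qed.

End Counting.

(** * Cardinalities as counts of words *)

Section Cardinals.

Local Open Scope classical_set_scope.

Lemma card_fset_set_count (T : choiceType) (S : eqType) (A : set T) (U : seq S)
    (g : S -> T) (p : pred S) :
    uniq U -> injective g ->
    (forall x, A x -> exists2 s, s \in U & x = g s) ->
    (forall s, s \in U -> A (g s) <-> p s) ->
  #|` fset_set A |%fset = count p U.
Proof.
move=> uU inj_g Ag gA.
have -> : A = [set` [fset x in map g (filter p U)]%fset].
  apply/seteqP; split=> x /=; rewrite inE.
    move=> Ax; have [s sU xE] := Ag x Ax; rewrite xE mem_map // mem_filter sU andbT.
    by apply/gA; rewrite // -xE.
  by case/mapP=> s; rewrite mem_filter => /andP[ps sU] ->; apply/gA.
rewrite set_fsetK card_fseq undup_id ?size_map ?size_filter //.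
by rewrite map_inj_uniq // filter_uniq.
Qed.

Variables (n m : nat) (u v : 'I_n -> nat).
Implicit Types (b : seq (colour n)).

Definition bound_counts b :=
  [forall i, (count (fun c => c.1 == i) b == u i)
          && (count (fun c => c.2 == i) b == v i)].

Lemma bound_countsP (X : eqType) (col : X -> colour n) (s : seq X) :
  (forall i, bound_a i (map col (rev s)) = u i /\ bound_b i (map col (rev s)) = v i)
  <-> bound_counts (bound_colours col s).
Proof.
have E (P : pred (colour n)) : count (fun c => is_bound c && P c) (map col (rev s))
    = count P (bound_colours col s).
  by rewrite map_rev count_rev count_filter; apply: eq_count => c /=; rewrite andbC.
rewrite /bound_a /bound_b; split=> [h|/forallP h i].
  by apply/forallP => i; have [<- <-] := h i; rewrite !E !eqxx.
by have /andP[/eqP <- /eqP <-] := h i; rewrite !E.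
Qed.

Lemma row_weight_ge (T : eqType) (l : seq (nat * T)) x :
  x \in l -> (x.1 <= row_weight l)%N.
Proof.
elim: l => //= y l IH; rewrite inE /row_weight /= => /orP[/eqP->|/IH xl].
  exact: leq_addr.
exact: leq_trans xl (leq_addl _ _).
Qed.

(** Gaps are non-negative, so sizes weakly increase when read backwards and positivity of the
    smallest part suffices. *)
Lemma in_P_rev (s : seq (nat * colour n)) :
  in_P (rev s) = init_path (@part_rel n) (fun x => 0 < x.1)%N s.
Proof.
rewrite /in_P all_rev rev_sorted; case: s => //= x s.
case: (ltnP 0 x.1) => //= x0; apply/andP/idP => [[]//|xs]; split=> //.
have le_tr : transitive (fun y z : nat * colour n => y.1 <= z.1)%N.
  by move=> y z t; apply: leq_trans.
have /(order_path_min le_tr) : path (fun y z => y.1 <= z.1)%N x s.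
  apply: sub_path xs => y z; rewrite -/(part_rel y z) part_relE.
  exact: leq_trans (leq_addr _ _).
by apply: sub_all => y; apply: leq_trans.
Qed.

Lemma Ptilde_count : Ptilde m u v =
  count (fun s => [&& init_path (@part_rel n) (fun x => 0 < x.1)%N s,
                      bound_counts (bound_colours snd s) & word_weight fst s == m])
    (all_words (part_letters m.+1 n) m.+2).
Proof.
apply: (@card_fset_set_count _ _ _ _ rev).
- exact/all_words_uniq/boxes_uniq.
- exact: (can_inj revK).
- move=> l [/andP[pos _] wl _]; exists (rev l); last by rewrite revK.
  (* Positive parts of total m number at most m. The enumeration also admits length m+1, to match
     the summation range of [sum_partition_gf] with M = m+1. *)
  rewrite mem_all_words size_rev all_rev; apply/andP; split.
    rewrite ltnS ltnW // ltnS -wl.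
    elim: l pos {wl} => //= x l IH /andP[x0 /IH]; rewrite /row_weight /= => h.
    by rewrite -add1n leq_add.
  by apply/allP => x xl /=; rewrite mem_boxes ltnS -wl row_weight_ge.
move=> s _; rewrite /Ptilde_set /= in_P_rev.
have -> : row_weight (rev s) = word_weight fst s.
  by rewrite /row_weight map_rev sumn_rev.
split=> [[-> -> /bound_countsP->]|/and3P[-> /bound_countsP h /eqP->]] //.
by rewrite eqxx.
Qed.

Definition array_of (s : seq (column n)) : array n :=
  (rev (map fst s), rev (map snd s)).

Lemma is_frobenius_array_of s :
  is_frobenius (array_of s) = init_path (@column_rel n) predT s.
Proof.
rewrite /is_frobenius /= !size_rev !size_map eqxx !rev_sorted !sorted_map /=.
case: s => //= x s; rewrite -path_relI.
by apply: eq_path.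
Qed.

Lemma frob_colours_array_of s :
  frob_colours (array_of s) = map (@column_colour n) (rev s).
Proof.
rewrite /frob_colours /= -!map_rev.
by elim: (rev s) => //= x t ->.
Qed.

Lemma frob_weight_array_of s :
  frob_weight (array_of s) = (size s + word_weight (@column_weight n) s)%N.
Proof.
rewrite /frob_weight /row_weight /= size_rev size_map !map_rev !sumn_rev -addnA.
congr (_ + _)%N; rewrite /word_weight.
by elim: s => //= x s <-; rewrite /column_weight addnACA.
Qed.

Lemma Ftilde_count : Ftilde m u v =
  count (fun s => [&& init_path (@column_rel n) predT s,
                      bound_counts (bound_colours (@column_colour n) s)
                    & size s + word_weight (@column_weight n) s == m])%N
    (all_words (column_letters m.+1 n) m.+2).
Proof.
apply: (@card_fset_set_count _ _ _ _ array_of).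
- apply: all_words_uniq; apply: allpairs_uniq; rewrite ?boxes_uniq //.
  by move=> [? ?] [? ?] _ _ [-> ->].
- move=> s t [/(can_inj revK) e1 /(can_inj revK) e2].
  by rewrite -[s]zip_unzip -[t]zip_unzip /unzip1 e1 /unzip2 e2.
- move=> f [/and3P[/eqP sz _ _] wf _]; pose s := zip (rev f.1) (rev f.2).
  have fE : f = array_of s.
    rewrite /array_of -/(unzip1 s) -/(unzip2 s) unzip1_zip ?unzip2_zip ?size_rev ?sz //.
    by rewrite !revK -surjective_pairing.
  exists s => //; rewrite mem_all_words; apply/andP; split.
    rewrite /s size_zip !size_rev sz minnn -sz ltnS ltnW // ltnS -wf.
    by rewrite /frob_weight -addnA leq_addr.
  apply/allP => x xs /=; apply/allpairsP; exists x; rewrite -surjective_pairing.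
  split=> //; rewrite mem_boxes ltnS -wf /frob_weight.
    have /row_weight_ge h : x.1 \in f.1 by rewrite fE mem_rev map_f.
    by rewrite (leq_trans h) // addnAC leq_addl.
  have /row_weight_ge h : x.2 \in f.2 by rewrite fE mem_rev map_f.
  by rewrite (leq_trans h) // leq_addl.
move=> s _; rewrite /Ftilde_set /= is_frobenius_array_of frob_weight_array_of.
rewrite frob_colours_array_of.
split=> [[-> -> /bound_countsP->]|/and3P[-> /bound_countsP h /eqP->]] //.
by rewrite eqxx.
Qed.

End Cardinals.

Theorem theorem1p27 (n : nat) (hn : (0 < n)%N) (m : nat) (u v : 'I_n -> nat) :
  Ptilde m u v = Ftilde m u v.
Proof.
case: n hn u v => // n' _ u v.
by rewrite Ptilde_count Ftilde_count; apply: count_parts_columns.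
Qed.
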